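(* Let $G_0\in\mathcal{E}_{k_0}(\Theta\times\Omega)$ be fixed, with $k_0\ge 1$ known. Suppose that the density family $\{f(x|\theta,\Sigma):\theta\in\Theta,\Sigma\in\Omega\}$ is identifiable in the first order and admits the uniform Lipschitz property up to the first order. Then there are positive constants $\epsilon_0$ and $C_0$, both depending on $G_0$, such that for every $G\in\mathcal{E}_{k_0}(\Theta\times\Omega)$ with $W_1(G,G_0)\le\epsilon_0$, $$V(p_G,p_{G_0})\ge C_0\,W_1(G,G_0).$$
   Context: Let $d_1\ge1$, $d_2\ge0$; $S_{d_2}^{++}$ is the set of symmetric positive definite $d_2\times d_2$ matrices; $\Theta\subset\mathbb{R}^{d_1}$, $\Omega\subset S_{d_2}^{++}$; $\{f(x|\theta,\Sigma)\}$ is a family of probability densities with respect to Lebesgue measure on a Euclidean space $\mathcal{X}$. $\mathcal{E}_k(\Theta\times\Omega)$ is the set of discrete probability measures on $\Theta\times\Omega$ with exactly $k$ distinct support points. For $G=\sum_{i}p_i\delta_{(\theta_i,\Sigma_i)}$, $p_G(x)=\sum_i p_i f(x|\theta_i,\Sigma_i)$. $V(p,q)=\frac12\int|p-q|\,dx$. For $r\ge1$ and $G=\sum_{i=1}^kp_i\delta_{(\theta_i,\Sigma_i)}$, $G'=\sum_{j=1}^{k'}p'_j\delta_{(\theta'_j,\Sigma'_j)}$, $$W_r(G,G')=\Big(\inf_{q}\sum_{i,j}q_{ij}(\|\theta_i-\theta'_j\|+\|\Sigma_i-\Sigma'_j\|)^r\Big)^{1/r},$$ the infimum over couplings $q=(q_{ij})\ge0$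 with $\sum_jq_{ij}=p_i$, $\sum_iq_{ij}=p'_j$; $\|\cdot\|$ is the Euclidean (for matrices: entrywise $\ell_2$) norm. $\lambda_1(\Sigma)$ and $\lambda_{d_2}(\Sigma)$ are the smallest and largest eigenvalues of $\Sigma$. Derivatives: $\partial f/\partial\Sigma$ is the $d_2\times d_2$ matrix with $(i,j)$ entry $\partial f/\partial\Sigma_{ij}$. Identifiable in the first order: $f$ is differentiable in $(\theta,\Sigma)$ and for any finite $k$ and any $k$ different pairs $(\theta_1,\Sigma_1),\dots,(\theta_k,\Sigma_k)\in\Theta\times\Omega$, if $\alpha_i\in\mathbb{R}$, $\beta_i\in\mathbb{R}^{d_1}$ and symmetric $\gamma_i\in\mathbb{R}^{d_2\times d_2}$ satisfy $$\sum_{i=1}^k\alpha_if(x|\theta_i,\Sigma_i)+\beta_i^T\frac{\partial f}{\partial\theta}(x|\theta_i,\Sigma_i)+\mathrm{tr}\Big(\frac{\partial f}{\partial\Sigma}(x|\theta_i,\Sigma_i)^T\gamma_i\Big)=0\quad\text{for almost all }x,$$ then $\alpha_i=0,\beta_i=0,\gamma_i=0$ for all $i$. Uniform Lipschitz property up to the first order: there are positive constants $\delta_1,\delta_2$ such that for any $R_1,R_2,R_3>0$ there are positive constants $C(R_1,R_2)$, $C(R_3)$ such that for all $\gamma_1\in\mathbb{R}^{d_1}$, $\gamma_2\in\mathbb{R}^{d_2\times d_2}$, all $\Sigma\in\Omega$ with $R_1\le\sqrt{\lambda_1(\Sigma)}\le\sqrt{\lambda_{d_2}(\Sigma)}\le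 R_2$, all $\theta\in\Theta$ with $\|\theta\|\le R_3$, all $\theta_1,\theta_2\in\Theta$, $\Sigma_1,\Sigma_2\in\Omega$ and all $x\in\mathcal{X}$, $$\Big|\gamma_1^T\Big(\frac{\partial f}{\partial\theta}(x|\theta_1,\Sigma)-\frac{\partial f}{\partial\theta}(x|\theta_2,\Sigma)\Big)\Big|\le C(R_1,R_2)\|\theta_1-\theta_2\|^{\delta_1}\|\gamma_1\|,$$ $$\Big|\mathrm{tr}\Big(\Big(\frac{\partial f}{\partial\Sigma}(x|\theta,\Sigma_1)-\frac{\partial f}{\partial\Sigma}(x|\theta,\Sigma_2)\Big)^T\gamma_2\Big)\Big|\le C(R_3)\|\Sigma_1-\Sigma_2\|^{\delta_2}\|\gamma_2\|.$$ *)

(* Defs.v *)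
From HB Require Import structures.
From mathcomp Require Import all_boot all_order all_algebra.
From mathcomp Require Import all_classical all_reals all_analysis.

Set Implicit Arguments.
Unset Strict Implicit.
Unset Printing Implicit Defensive.
Import Order.TTheory GRing.Theory Num.Theory.
Import numFieldNormedType.Exports.
Local Open Scope classical_set_scope.
Local Open Scope ring_scope.

Section tuple_product.
Context d (T : measurableType d) (R : realType) (m : nat).
Variables (nu : {sigma_finite_measure set T -> \bar R})
          (mu : {sigma_finite_measure set (m.-tuple T) -> \bar R}).

Definition tuple_cons (p : T * m.-tuple T) : m.+1.-tuple T :=
  [tuple of p.1 :: p.2].

Lemma measurable_tuple_cons : measurable_fun setT tuple_cons.
Proof. exact: measurable_cons. Qed.

Definition tuple_product : set (m.+1.-tuple T) -> \bar R :=
  pushforward (nu \x mu)%E tuple_cons.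

Let mcons := measurable_tuple_cons.

Let tuple_product0 : tuple_product set0 = 0%E.
Proof. exact: measure0. Qed.

Let tuple_product_ge0 A : (0 <= tuple_product A)%E.
Proof. exact: measure_ge0. Qed.

Let tuple_product_sigma_additive : semi_sigma_additive tuple_product.
Proof. exact: measure_semi_sigma_additive. Qed.

HB.instance Definition _ := isMeasure.Build _ _ _ tuple_product
  tuple_product0 tuple_product_ge0 tuple_product_sigma_additive.

Let tuple_product_sigma_finite : sigma_finite setT tuple_product.
Proof.
have /sigma_finiteP[F [TF ndF Foo]] := sigma_finiteT nu.
have /sigma_finiteP[G [TG ndG Goo]] := sigma_finiteT mu.
pose H k : set (m.+1.-tuple T) :=
  [set t | F k (thead t) /\ G k [tuple of behead t]].
exists H.
  rewrite predeqE => t; split => // _.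
  have [i _ Fi] : (\bigcup_i F i) (thead t) by rewrite -TF.
  have [j _ Gj] : (\bigcup_i G i) [tuple of behead t] by rewrite -TG.
  exists (maxn i j) => //; split.
  - by move: Fi; exact/subsetPset/ndF/leq_maxl.
  - by move: Gj; exact/subsetPset/ndG/leq_maxr.
move=> k; have [mF Fk] := Foo k; have [mG Gk] := Goo k; split.
  apply: measurableI.
  - by rewrite -[X in measurable X]setTI; exact: (measurable_tnth ord0).
  - by rewrite -[X in measurable X]setTI; exact: measurable_behead.
rewrite /tuple_product /pushforward.
have -> : tuple_cons @^-1` H k = F k `*` G k.
  rewrite predeqE => -[a t]; rewrite /H /= theadE.
  by have -> : [tuple of behead (tuple_cons (a, t))] = t by exact/val_inj.
by rewrite product_measure1E// lte_mul_pinfty// ge0_fin_numE.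
Qed.

HB.instance Definition _ :=
  Measure_isSigmaFinite.Build _ _ _ tuple_product tuple_product_sigma_finite.

End tuple_product.

(* Points of the Euclidean space R^m are m-tuples, with the product (Borel)
   sigma-algebra. *)
Notation euclidean R m := (m.-tuple (measurableTypeR R)).

(* The m-fold product of the Lebesgue measure of the real line; R^0 is a single
   point, of mass 1. *)
Fixpoint lebesgue_euclidean (R : realType) (m : nat) :
    {sigma_finite_measure set (euclidean R m) -> \bar R} :=
  match m with
  | 0 => dirac ([tuple] : euclidean R 0)
  | m'.+1 => tuple_product (@lebesgue_measure R) (lebesgue_euclidean R m')
  end.

Section first_order.
Context (R : realType) (d1 d2 m : nat).

Implicit Types (Theta : set 'cV[R]_d1) (Omega : set 'M[R]_d2).
Implicit Types (f : euclidean R m -> 'cV[R]_d1 -> 'M[R]_d2 -> R).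

(* The norm `|A| of the library is the sup norm of the entries. *)
Definition l2norm p q (A : 'M[R]_(p, q)) : R :=
  Num.sqrt (\sum_i \sum_j A i j ^+ 2).

Definition spd : set 'M[R]_d2 :=
  [set S | S^T = S /\
    forall v : 'cV[R]_d2, v != 0 -> 0 < (v^T *m S *m v) 0 0].

Definition smallest_eigenvalue (S : 'M[R]_d2) (l : R) : Prop :=
  eigenvalue S l /\ forall l', eigenvalue S l' -> l <= l'.

Definition largest_eigenvalue (S : 'M[R]_d2) (l : R) : Prop :=
  eigenvalue S l /\ forall l', eigenvalue S l' -> l' <= l.

(* R1 <= sqrt (lambda_1 S) <= sqrt (lambda_d2 S) <= R2; there is no
   constraint when d2 = 0. *)
Definition eigenvalue_bounds (R1 R2 : R) (S : 'M[R]_d2) : Prop :=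
  forall lmin lmax, smallest_eigenvalue S lmin -> largest_eigenvalue S lmax ->
    [/\ R1 <= Num.sqrt lmin, Num.sqrt lmin <= Num.sqrt lmax
      & Num.sqrt lmax <= R2].

Definition is_density (g : euclidean R m -> R) : Prop :=
  [/\ measurable_fun setT g, forall x, 0 <= g x
    & (\int[lebesgue_euclidean R m]_x (g x)%:E = 1)%E].

(* f x is a function on all of 'cV_d1 * 'M_d2, so that d/dS_ij is the partial
   derivative in the (i, j) entry, the d2 * d2 entries being independent
   variables. The values of f x off Theta * Omega matter only through the
   derivatives at the points of Theta * Omega. A function that is given for
   symmetric S only is covered by S |-> f x th (2^-1 *: (S + S^T)). *)
Definition dtheta f x (th : 'cV[R]_d1) (S : 'M[R]_d2) : 'cV[R]_d1 :=
  \col_i 'D_(delta_mx i 0) (fun t => f x t S) th.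

Definition dSigma f x (th : 'cV[R]_d1) (S : 'M[R]_d2) : 'M[R]_d2 :=
  \matrix_(i, j) 'D_(delta_mx i j) (f x th) S.

Definition differentiable_family Theta Omega f : Prop :=
  forall x th S, Theta th -> Omega S ->
    differentiable (fun p : 'cV[R]_d1 * 'M[R]_d2 => f x p.1 p.2) (th, S).

Definition identifiable1 Theta Omega f : Prop :=
  differentiable_family Theta Omega f /\
  forall (k : nat) (th : 'I_k -> 'cV[R]_d1) (S : 'I_k -> 'M[R]_d2),
    (forall i, Theta (th i)) -> (forall i, Omega (S i)) ->
    injective (fun i => (th i, S i)) ->
  forall (a : 'I_k -> R) (b : 'I_k -> 'cV[R]_d1) (c : 'I_k -> 'M[R]_d2),
    (forall i, (c i)^T = c i) ->
    {ae lebesgue_euclidean R m, forall x,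
      \sum_i (a i * f x (th i) (S i)
              + ((b i)^T *m dtheta f x (th i) (S i)) 0 0
              + \tr ((dSigma f x (th i) (S i))^T *m c i)) = 0} ->
  forall i, [/\ a i = 0, b i = 0 & c i = 0].

Definition uniform_lipschitz1 Theta Omega f : Prop :=
  exists delta1 delta2 : R, [/\ 0 < delta1, 0 < delta2 &
  exists (C1 : R -> R -> R) (C2 : R -> R),
  forall R1 R2 R3 : R, 0 < R1 -> 0 < R2 -> 0 < R3 ->
  [/\ 0 < C1 R1 R2, 0 < C2 R3 &
  forall (g1 : 'cV[R]_d1) (g2 : 'M[R]_d2)
    (S : 'M[R]_d2) (th : 'cV[R]_d1)
    (th1 th2 : 'cV[R]_d1) (S1 S2 : 'M[R]_d2) (x : euclidean R m),
  Omega S -> eigenvalue_bounds R1 R2 S -> Theta th -> l2norm th <= R3 ->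
  Theta th1 -> Theta th2 -> Omega S1 -> Omega S2 ->
    `|(g1^T *m (dtheta f x th1 S - dtheta f x th2 S)) 0 0|
      <= C1 R1 R2 * l2norm (th1 - th2) `^ delta1 * l2norm g1
    /\
    `|\tr ((dSigma f x th S1 - dSigma f x th S2)^T *m g2)|
      <= C2 R3 * l2norm (S1 - S2) `^ delta2 * l2norm g2]].

(* \sum_i weight i * delta_(loc i, scale i) *)
Record mixing (k : nat) := Mixing {
  weight : 'I_k -> R;
  loc : 'I_k -> 'cV[R]_d1;
  scale : 'I_k -> 'M[R]_d2 }.

(* The probability measures with exactly k support points, which all lie in
   Theta * Omega. *)
Definition mixing_in Theta Omega k (G : mixing k) : Prop :=
  [/\ forall i, 0 < weight G i, \sum_i weight G i = 1,
      injective (fun i => (loc G i, scale G i))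
    & forall i, Theta (loc G i) /\ Omega (scale G i)].

Definition mixture f k (G : mixing k) (x : euclidean R m) : R :=
  \sum_i weight G i * f x (loc G i) (scale G i).

Definition tv_distance (p q : euclidean R m -> R) : \bar R :=
  ((2^-1)%:E * \int[lebesgue_euclidean R m]_x `|p x - q x|%:E)%E.

Definition coupling k k' (G : mixing k) (G' : mixing k') (q : 'M[R]_(k, k')) :
    Prop :=
  [/\ forall i j, 0 <= q i j, forall i, \sum_j q i j = weight G i
    & forall j, \sum_i q i j = weight G' j].

Definition transport_cost (r : R) k k' (G : mixing k) (G' : mixing k')
    (q : 'M[R]_(k, k')) : R :=
  \sum_i \sum_j q i j *
    (l2norm (loc G i - loc G' j) + l2norm (scale G i - scale G' j)) `^ r.

Definition wasserstein (r : R) k k' (G : mixing k) (G' : mixing k') : R :=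
  (inf [set transport_cost r G G' q | q in coupling G G']) `^ r^-1.

End first_order.

(* Main.v *)
(* The proof is by contradiction and compactness. If the inequality fails,
   there are G_n with W_1(G_n, G0) -> 0 and V(p_(G_n), p_(G0)) <= c_n
   W_1(G_n, G0) for as small c_n as we like. For small W_1 each atom of G0
   is close to exactly one atom of G_n; after relabelling, W_1(G_n, G0) is
   comparable to D_n, the sum of the deviations of the weights and of the
   atoms. With c_n geometric, the L1 norms of (p_(G_n) - p_(G0)) / D_n are
   summable, so these functions tend to 0 almost everywhere. Along an
   ultrafilter, the deviations divided by D_n converge, to limits that are
   not all zero, and by differentiability of f at the atoms of G0 the same
   functions converge, at every x, to the first-order combination that has
   these limits as coefficients. That combination vanishes almost
   everywhere, against identifiability. *)
Require Import Defs.
From mathcomp Require Import all_boot all_order all_algebra.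
From mathcomp Require Import all_classical all_reals all_analysis.
From mathcomp Require Import measurable_realfun ring lra.

Set Implicit Arguments.
Unset Strict Implicit.
Unset Printing Implicit Defensive.
Import Order.TTheory GRing.Theory Num.Theory.
Import numFieldNormedType.Exports.
Local Open Scope classical_set_scope.
Local Open Scope ring_scope.

(** * Comparison of the entrywise l2 norm with the sup norm *)

Lemma normr_le_l2norm (R : realType) p q (A : 'M[R]_(p, q)) : `|A| <= l2norm A.
Proof.
have [/= A0|] := eqVneq `|A| 0; first by rewrite A0 sqrtr_ge0.
move=> /mx_norm_neq0[[i j] /= Aij]; rewrite [leLHS]Aij -sqrtr_sqr.
rewrite ler_wsqrtr//= (bigD1 i)//= (bigD1 j)//= -addrA lerDl addr_ge0//.
  by rewrite sumr_ge0// => *; exact: sqr_ge0.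
by rewrite sumr_ge0// => *; rewrite sumr_ge0// => *; exact: sqr_ge0.
Qed.

Lemma entry_le_normr (R : realType) p q (A : 'M[R]_(p, q)) i j :
  `|A i j| <= `|A|.
Proof.
rewrite [leRHS]mx_normrE.
exact: (le_bigmax _ (fun ij : 'I_p * 'I_q => `|A ij.1 ij.2|) (i, j)).
Qed.

Lemma l2norm_le_normr (R : realType) p q (A : 'M[R]_(p, q)) :
  l2norm A <= Num.sqrt (p * q)%:R * `|A|.
Proof.
rewrite -[X in _ * X]ger0_norm// -sqrtr_sqr -sqrtrM// ler_wsqrtr//.
have sumE n (x : R) : n%:R * x = \sum_(i < n) x.
  by rewrite sumr_const card_ord mulr_natl.
rewrite natrM -mulrA sumE; apply: ler_sum => i _.
rewrite sumE; apply: ler_sum => j _.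
by rewrite -(real_normK (num_real (A i j))) lerXn2r ?nnegrE ?entry_le_normr.
Qed.

(** The ground metric of the transport cost. Differentiability refers to the norm of the product
    space, a maximum of sup norms, so estimates have to pass between the two. *)
Definition ground_dist (R : realType) d1 d2 (u v : 'cV[R]_d1 * 'M[R]_d2) : R :=
  l2norm (u.1 - v.1) + l2norm (u.2 - v.2).

Lemma normr_le_ground_dist (R : realType) d1 d2 (u v : 'cV[R]_d1 * 'M[R]_d2) :
  `|u - v| <= ground_dist u v.
Proof.
rewrite prod_normE ge_max; apply/andP; split.
  by rewrite (le_trans (normr_le_l2norm _))// lerDl sqrtr_ge0.
by rewrite (le_trans (normr_le_l2norm _))// lerDr sqrtr_ge0.
Qed.

Lemma ground_dist_ge0 (R : realType) d1 d2 (u v : 'cV[R]_d1 * 'M[R]_d2) :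
  0 <= ground_dist u v.
Proof. by rewrite addr_ge0 ?sqrtr_ge0. Qed.

(** A Lipschitz constant: an l2 norm is at most the sup norm times the square root of the number of
    entries, and [d1 * 1] counts the entries of a column. *)
Definition norm_ratio (R : realType) d1 d2 : R :=
  Num.sqrt (d1 * 1)%:R + Num.sqrt (d2 * d2)%:R.

Lemma norm_ratio_ge0 (R : realType) d1 d2 : 0 <= norm_ratio R d1 d2.
Proof. by rewrite addr_ge0 ?sqrtr_ge0. Qed.

Lemma ground_dist_le_normr (R : realType) d1 d2 (u v : 'cV[R]_d1 * 'M[R]_d2) :
  ground_dist u v <= norm_ratio R d1 d2 * `|u - v|.
Proof.
rewrite mulrDl prod_normE lerD//.
  rewrite (le_trans (l2norm_le_normr _))// ler_wpM2l ?sqrtr_ge0//.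
  by rewrite le_max lexx.
rewrite (le_trans (l2norm_le_normr _))// ler_wpM2l ?sqrtr_ge0//.
by rewrite le_max lexx orbT.
Qed.

(** * Couplings, W_1 and the deviation between atoms of equal label *)

Definition atom (R : realType) d1 d2 k (G : mixing R d1 d2 k) (i : 'I_k) :
  'cV[R]_d1 * 'M[R]_d2 := (loc G i, scale G i).

Lemma transport_cost1E (R : realType) d1 d2 k k' (G : mixing R d1 d2 k)
    (G' : mixing R d1 d2 k') (q : 'M[R]_(k, k')) :
  transport_cost 1 G G' q =
    \sum_i \sum_j q i j * ground_dist (atom G i) (atom G' j).
Proof.
rewrite /transport_cost; apply: eq_bigr => i _; apply: eq_bigr => j _.
by rewrite powRr1//; exact: (ground_dist_ge0 (atom G i) (atom G' j)).
Qed.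

Lemma transport_cost1_ge0 (R : realType) d1 d2 k k' (G : mixing R d1 d2 k)
    (G' : mixing R d1 d2 k') (q : 'M[R]_(k, k')) :
  coupling G G' q -> 0 <= transport_cost 1 G G' q.
Proof.
case=> q0 _ _; rewrite transport_cost1E; apply: sumr_ge0 => i _.
by apply: sumr_ge0 => j _; rewrite mulr_ge0// ground_dist_ge0.
Qed.

(** The independent coupling serves as a witness that the infimum in [wasserstein] is over a
    non-empty set. *)
Lemma product_coupling (R : realType) d1 d2 k k' (G : mixing R d1 d2 k)
    (G' : mixing R d1 d2 k') :
  (forall i, 0 <= weight G i) -> \sum_i weight G i = 1 ->
  (forall j, 0 <= weight G' j) -> \sum_j weight G' j = 1 ->
  coupling G G' (\matrix_(i, j) (weight G i * weight G' j)).
Proof.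
move=> G0 G1 G'0 G'1; split=> [i j|i|j]; first by rewrite mxE mulr_ge0.
  by under eq_bigr do rewrite mxE; rewrite -mulr_sumr G'1 mulr1.
by under eq_bigr do rewrite mxE; rewrite -mulr_suml G1 mul1r.
Qed.

Lemma wasserstein1E (R : realType) d1 d2 k k' (G : mixing R d1 d2 k)
    (G' : mixing R d1 d2 k') (q : 'M[R]_(k, k')) :
  coupling G G' q ->
  wasserstein 1 G G' = inf [set transport_cost 1 G G' q | q in coupling G G'].
Proof.
move=> Gq; rewrite /wasserstein invr1 powRr1//.
apply: lb_le_inf; first by exists (transport_cost 1 G G' q), q.
by move=> _ [q' Gq' <-]; exact: transport_cost1_ge0.
Qed.

Lemma wasserstein1_le (R : realType) d1 d2 k k' (G : mixing R d1 d2 k)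
    (G' : mixing R d1 d2 k') (q : 'M[R]_(k, k')) :
  coupling G G' q -> wasserstein 1 G G' <= transport_cost 1 G G' q.
Proof.
move=> Gq; rewrite (wasserstein1E Gq); apply: ge_inf; last by exists q.
by exists 0 => _ [q' Gq' <-]; exact: transport_cost1_ge0.
Qed.

(** A near-optimal coupling, obtained from the definition of the infimum alone. *)
Lemma wasserstein1_lt (R : realType) d1 d2 k k' (G : mixing R d1 d2 k)
    (G' : mixing R d1 d2 k') (q : 'M[R]_(k, k')) c :
  coupling G G' q -> wasserstein 1 G G' < c ->
  exists2 q', coupling G G' q' & transport_cost 1 G G' q' < c.
Proof.
move=> Gq; rewrite (wasserstein1E Gq) => /inf_lt[|_ [q' Gq' <-] q'c].
  by exists (transport_cost 1 G G' q), q.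
by exists q'.
Qed.

(* Each atom of G' is matched with the nearest atom of G; a mass that q moves
   between unmatched atoms travels at least delta / 2, so it is small. *)
Lemma matching (R : realType) d1 d2 k (G G' : mixing R d1 d2 k)
    (q : 'M[R]_k) (pmin delta c : R) :
  0 < pmin -> (forall j, pmin <= weight G' j) ->
  0 < delta -> (forall i j, i != j -> delta <= `|atom G' i - atom G' j|) ->
  coupling G G' q -> transport_cost 1 G G' q <= c -> c / pmin < delta / 2 ->
  exists2 s : 'I_k -> 'I_k, injective s & forall j,
    `|atom G (s j) - atom G' j| <= c / pmin /\
    `|weight G (s j) - weight G' j| <= c / (delta / 2).
Proof.
move=> pmin0 pminP delta0 deltaP [q0 qG qG']; rewrite transport_cost1E => qc cd.
pose d i j := ground_dist (atom G i) (atom G' j).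
have qd0 i j : 0 <= q i j * d i j by rewrite mulr_ge0// ground_dist_ge0.
have row_cost i : \sum_j q i j * d i j <= c.
  rewrite (le_trans _ qc)// [leRHS](bigD1 i)//= lerDl sumr_ge0// => l _.
  by apply: sumr_ge0 => j _; exact: qd0.
have col_cost j : \sum_i q i j * d i j <= c.
  rewrite (le_trans _ qc)// [leRHS]exchange_big [leRHS](bigD1 j)//= lerDl.
  by apply: sumr_ge0 => l _; apply: sumr_ge0 => i _; exact: qd0.
pose s j := [arg min_(i < j) d i j]%O.
(* Column [j] has mass at least [pmin], and every part of it travels at least the minimal distance
   [d (s j) j]. *)
have sP j : d (s j) j <= c / pmin.
  rewrite ler_pdivlMr// mulrC (le_trans _ (col_cost j))//.
  rewrite (@le_trans _ _ (weight G' j * d (s j) j))//.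
    by rewrite ler_wpM2r ?ground_dist_ge0.
  rewrite -qG' mulr_suml; apply: ler_sum => i _; rewrite ler_wpM2l//.
  by rewrite /s; case: arg_minP => // l _; apply.
have sN j : `|atom G (s j) - atom G' j| <= c / pmin.
  exact: le_trans (normr_le_ground_dist _ _) (sP j).
(* Triangle inequality: atoms [j] and [j'] of [G'] are at least [delta] apart, and atom [s j] of [G]
   is within [delta / 2] of the former. *)
have far j j' : j != j' -> delta / 2 <= d (s j) j'.
  move=> /deltaP jj'; apply: le_trans (normr_le_ground_dist _ _).
  have := le_trans jj' (ler_distD (atom G (s j)) (atom G' j) (atom G' j')).
  rewrite (distrC (atom G' j)) => /le_trans/(_ (lerD (sN j) (lexx _))) h.
  rewrite -(lerD2l (delta / 2)) -splitr (le_trans h)// lerD2r.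
  exact: ltW.
have s_inj : injective s.
  move=> j j' sj; apply/eqP/negPn/negP => /far.
  rewrite sj leNgt => /negP; apply.
  exact: le_lt_trans (sP _) cd.
exists s => // j; split=> //.
(* Both weights contain [q (s j) j]. What remains is a difference of two numbers between 0 and
   [c / (delta / 2)], so the bound does not double. *)
rewrite -qG -qG' (bigD1 j)//= [X in _ - X](bigD1 (s j))//=.
rewrite opprD addrACA subrr add0r.
set A := \sum_(_ | _) _; set B := \sum_(_ | _) _.
have half0 : 0 < delta / 2 by rewrite divr_gt0.
have A0 : 0 <= A by exact: sumr_ge0.
have B0 : 0 <= B by exact: sumr_ge0.
have Ac : A <= c / (delta / 2).
  rewrite ler_pdivlMr// (le_trans _ (row_cost (s j)))// [leRHS](bigD1 j)//=.
  rewrite mulr_suml (@le_trans _ _ (\sum_(l | l != j) q (s j) l * d (s j) l))//.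
    apply: ler_sum => l lj.
    by rewrite ler_wpM2l// far// eq_sym.
  by rewrite lerDr.
have Bc : B <= c / (delta / 2).
  rewrite ler_pdivlMr// (le_trans _ (col_cost j))// [leRHS](bigD1 (s j))//=.
  rewrite mulr_suml (@le_trans _ _ (\sum_(l | l != s j) q l j * d l j))//.
    (* An injection of ['I_k] into itself is onto, so atom [l] is itself matched, with an index
       other than [j], and [far] applies. *)
    apply: ler_sum => l; rewrite -(f_invF s_inj l) (inj_eq s_inj) => lj.
    by rewrite ler_wpM2l// far.
  by rewrite lerDr.
by rewrite ler_norml lerBrDl lerBlDr; apply/andP; split; lra.
Qed.

Definition deviation (R : realType) d1 d2 k (G G' : mixing R d1 d2 k) : R :=
  \sum_j (`|weight G j - weight G' j| + `|atom G j - atom G' j|).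

(* Keep as much mass as possible between atoms of equal index, and send the
   excess masses to the missing ones by the (normalised) product coupling. *)
Lemma wasserstein1_le_deviation (R : realType) d1 d2 k
    (G G' : mixing R d1 d2 k) :
  (forall i, 0 <= weight G i) -> \sum_i weight G i = 1 ->
  (forall i, 0 <= weight G' i) -> \sum_i weight G' i = 1 ->
  wasserstein 1 G G' <= norm_ratio R d1 d2 *
    (2 + \sum_i \sum_j `|atom G' i - atom G' j|) * deviation G G'.
Proof.
move=> wG0 wG1 wG'0 wG'1.
pose m i := Num.min (weight G i) (weight G' i).
pose r i := weight G i - m i.
pose s i := weight G' i - m i.
pose t := \sum_i r i.
have r0 i : 0 <= r i by rewrite subr_ge0 ge_min lexx.
have s0 i : 0 <= s i by rewrite subr_ge0 ge_min lexx orbT.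
have m0 i : 0 <= m i by rewrite le_min wG0 wG'0.
have m1 i : m i <= 1.
  by rewrite ge_min -wG1 (bigD1 i)//= lerDl sumr_ge0.
have r1 i : r i <= 1.
  rewrite (@le_trans _ _ (weight G i)) ?gerBl// -wG1 (bigD1 i)//= lerDl.
  exact: sumr_ge0.
have rle i : r i <= `|weight G i - weight G' i|.
  rewrite /r /m /Order.min; case: ifP => _; first by rewrite subrr.
  exact: ler_norm.
have ts : \sum_i s i = t by rewrite /t /r /s !sumrB wG1 wG'1.
have t0 : 0 <= t by exact: sumr_ge0.
(* If [t] is 0, the quotient is 0 by convention, and so is each [u i], a non-negative term of a zero
   sum. *)
have cancelt (u : 'I_k -> R) : (forall i, 0 <= u i) -> \sum_i u i = t ->
    forall i, u i * t / t = u i.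
  move=> u0 ut i; have [tE|tn0] := eqVneq t 0; last by rewrite mulfK.
  rewrite tE mulr0 mul0r; apply/esym/eqP.
  have /eqP := ut; rewrite tE psumr_eq0// => /allP/(_ i).
  by rewrite mem_index_enum; exact.
pose q : 'M[R]_k :=
  \matrix_(i, j) ((if i == j then m i else 0) + r i * s j / t).
have cq : coupling G G' q.
  split=> [i j|i|j].
  - by rewrite mxE addr_ge0// ?divr_ge0 ?mulr_ge0//; case: ifP.
  - under eq_bigr do rewrite mxE.
    rewrite big_split/= -mulr_suml -mulr_sumr ts cancelt//.
    rewrite (bigD1 i)//= eqxx big1 ?addr0 => [|j /negPf].
      by rewrite addrC subrK.
    by rewrite eq_sym => ->.
  - under eq_bigr do rewrite mxE.
    rewrite big_split/= -big_mkcond/= big_pred1_eq -mulr_suml -mulr_suml.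
    by rewrite -/t (mulrC t) cancelt// addrC subrK.
apply: le_trans (wasserstein1_le cq) _; rewrite transport_cost1E.
set M := \sum_i \sum_j `|_|.
have M0 : 0 <= M.
  by apply: sumr_ge0 => i _; apply: sumr_ge0 => j _; exact: normr_ge0.
have Mle i j : `|atom G' i - atom G' j| <= M.
  rewrite /M (bigD1 i)//= (bigD1 j)//= -addrA lerDl addr_ge0//.
    by apply: sumr_ge0 => l _; exact: normr_ge0.
  by apply: sumr_ge0 => l _; apply: sumr_ge0 => ? _; exact: normr_ge0.
pose K := norm_ratio R d1 d2.
have K0 : 0 <= K by exact: norm_ratio_ge0.
pose D i := `|atom G i - atom G' i|.
have dle i j : ground_dist (atom G i) (atom G' j) <= K * (D i + M).
  apply: le_trans (ground_dist_le_normr _ _) _; rewrite ler_wpM2l//.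
  by rewrite (le_trans (ler_distD (atom G' i) _ _))// lerD.
(* Kept mass costs at most [K * D i] since [m i <= 1], and excess mass at most
   [r i * (K * (D i + M))]. As [r i] is at most 1 and at most the weight deviation, the factor
   [2 + M] suffices. *)
have row i : \sum_j q i j * ground_dist (atom G i) (atom G' j) <=
    K * (2 + M) * (`|weight G i - weight G' i| + D i).
  apply: (@le_trans _ _ (K * D i + r i * (K * (D i + M)))).
    under eq_bigr do rewrite mxE mulrDl.
    rewrite big_split/= lerD//.
      rewrite (bigD1 i)//= eqxx big1 ?addr0 => [|j /negPf].
        rewrite (le_trans (ler_wpM2r (ground_dist_ge0 _ _) (m1 i)))// mul1r.
        exact: ground_dist_le_normr.
      by rewrite eq_sym => ->; rewrite mul0r.
    rewrite -[r i in leRHS](cancelt r)// -[X in r i * X / _]ts.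
    rewrite mulr_sumr 2!mulr_suml.
    by apply: ler_sum => j _; rewrite ler_wpM2l// ?divr_ge0// mulr_ge0.
  have Di0 : 0 <= D i by exact: normr_ge0.
  have rD : r i * D i <= D i by rewrite ler_piMl.
  have rM : r i * M <= `|weight G i - weight G' i| * M by rewrite ler_wpM2r.
  have MD : 0 <= M * D i by rewrite mulr_ge0.
  rewrite mulrCA -mulrDr -mulrA ler_wpM2l//.
  have := normr_ge0 (weight G i - weight G' i); nra.
by rewrite (le_trans (ler_sum _ (fun i _ => row i)))// -mulr_sumr.
Qed.

(** * Limits along filters, differentials and almost everywhere convergence *)

(** Compactness of a segment gives a cluster point, and an ultrafilter converges to its cluster
    points. One ultrafilter thus serves all coordinates at once, in place of successive
    subsequences. *)
Lemma ultra_bounded_cvg (R : realType) T (U : set_system T)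
    {UU : UltraFilter U} (u : T -> R) (M : R) :
  (forall t, `|u t| <= M) -> exists l : R, u t @[t --> U] --> l.
Proof.
move=> uM.
have [l [_ ul]] : `[- M, M] `&` cluster (u t @[t --> U]) !=set0.
  apply: segment_compact; apply: (@filterE _ U) => t /=.
  rewrite in_itv/= -ler_norml; exact: uM.
exists l => A lA; have [//|UnA] := in_ultra_setVsetC (u @^-1` A) UU.
by have [y []] := ul (~` A) A UnA lA.
Qed.

(** The remainder is o(h) and [h] is dominated by [D]; dividing by the positive [D] also covers the
    indices where [h] vanishes. *)
Lemma diff_remainder_cvg (R : realType) (V : normedModType R) T
    (F : set_system T) {FF : Filter F} (g : V -> R) (p : V) (h : T -> V)
    (D : T -> R) :
  differentiable g p -> (forall t, 0 < D t) -> (forall t, `|h t| <= D t) ->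
  D t @[t --> F] --> 0 ->
  (g (p + h t) - g p - 'd g p (h t)) / D t @[t --> F] --> 0.
Proof.
move=> /diff_locally/eqaddoP dg D0 hD Dto0; apply/cvgrPdist_le => e e0.
have /nbhs_norm0P[r /= r0 rP] := dg _ e0.
have /cvgrPdist_lt/(_ _ r0) := Dto0; apply: filterS => t.
rewrite !sub0r !normrN normrM normfV (gtr0_norm (D0 t)) => Dr.
rewrite ler_pdivrMr//.
have := rP (h t) (le_lt_trans (hD t) Dr).
have -> : (g \o shift p - (cst (g p) + 'd g p)) (h t) =
    g (p + h t) - g p - 'd g p (h t) by rewrite /= [p + _]addrC -addrA -opprD.
move=> /le_trans; apply.
by rewrite ler_wpM2l// ltW.
Qed.

(** The total differential is linear, and its values on the canonical basis of the product space are
    the partial derivatives that make up [dtheta] and [dSigma]. *)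
Lemma diff_partialE (R : realType) d1 d2 (g : 'cV[R]_d1 -> 'M[R]_d2 -> R)
    (th : 'cV[R]_d1) (S : 'M[R]_d2) (h : 'cV[R]_d1 * 'M[R]_d2) :
  differentiable (fun p : 'cV[R]_d1 * 'M[R]_d2 => g p.1 p.2) (th, S) ->
  'd (fun p : 'cV[R]_d1 * 'M[R]_d2 => g p.1 p.2) (th, S) h =
  \sum_i h.1 i 0 * 'D_(delta_mx i 0) (fun t => g t S) th +
  \sum_i \sum_j h.2 i j * 'D_(delta_mx i j) (g th) S.
Proof.
move=> dg; set g' := fun p => _.
have pairD (u v : 'cV[R]_d1 * 'M[R]_d2) : u + v = (u.1 + v.1, u.2 + v.2) by [].
have pairZ (e : R) (u : 'cV[R]_d1 * 'M[R]_d2) :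
    e *: u = (e *: u.1, e *: u.2) by [].
have D1 i : 'd g' (th, S) (delta_mx i 0, 0) =
    'D_(delta_mx i 0) (fun t => g t S) th.
  rewrite -deriveE// /derive.
  under eq_fun => e do rewrite /= pairZ pairD /g'/= scaler0 add0r.
  by [].
have D2 i j : 'd g' (th, S) (0, delta_mx i j) = 'D_(delta_mx i j) (g th) S.
  rewrite -deriveE// /derive.
  under eq_fun => e do rewrite /= pairZ pairD /g'/= scaler0 add0r.
  by [].
have hE : h = \sum_i h.1 i 0 *: (delta_mx i 0, 0) +
              \sum_i \sum_j h.2 i j *: (0, delta_mx i j).
  have fstD (I : finType) (F : I -> 'cV[R]_d1 * 'M[R]_d2) :
      \sum_i F i = (\sum_i (F i).1, \sum_i (F i).2).
    by elim/big_rec3: _ => [//|i u v w _ ->].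
  rewrite pairD !fstD/= [h in LHS]surjective_pairing; congr pair.
    rewrite [X in _ + X]big1 => [|i _]; last first.
      by rewrite fstD/=; apply: big1 => j _; exact: scaler0.
    rewrite addr0 [LHS]matrix_sum_delta; apply: eq_bigr => i _.
    by rewrite big_ord1.
  rewrite [X in X + _]big1 => [|i _]; last exact: scaler0.
  rewrite add0r.
  by rewrite [LHS]matrix_sum_delta; apply: eq_bigr => i _; rewrite fstD.
rewrite [in LHS]hE linearD !linear_sum; congr (_ + _).
  by apply: eq_bigr => i _; rewrite linearZ D1.
apply: eq_bigr => i _; rewrite linear_sum.
by apply: eq_bigr => j _; rewrite linearZ D2.
Qed.

(** The bounds are geometric with sum [e], so the sum of the absolute values is integrable, hence
    finite almost everywhere; the terms of a convergent series tend to 0. *)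
Lemma ae_cvg0_summable_norm1 d (T : measurableType d) (R : realType)
    (mu : {measure set T -> \bar R}) (g : nat -> T -> R) (e : R) :
  0 <= e -> (forall n, measurable_fun setT (g n)) ->
  (forall n, (\int[mu]_x `|g n x|%:E <= (e / (2 ^ n.+1)%:R)%:E)%E) ->
  {ae mu, forall x, g n x @[n --> \oo] --> 0}.
Proof.
move=> e0 mg ge.
pose S : T -> \bar R := fun x => (\sum_(0 <= n <oo) `|g n x|%:E)%E.
have mS : measurable_fun [set: T] S.
  apply: (ge0_emeasurable_sum (P := xpredT)) => [n x _ _|n _].
    by rewrite lee_fin.
  exact/measurable_EFinP/measurableT_comp.
have S0 x : (0 <= S x)%E by apply: nneseries_ge0 => n _ _; rewrite lee_fin.
have iS : mu.-integrable setT S.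
  apply/integrableP; split=> //.
  under eq_integral do rewrite gee0_abs//.
  rewrite integral_nneseries//.
  apply: (le_lt_trans _ (ltry e)).
  apply: (le_trans _ (epsilon_trick0 xpredT e0)).
  apply: lee_nneseries => [n _ _|n _]; last exact: ge.
    by apply: integral_ge0 => x _; rewrite lee_fin.
  by move=> n; exact/measurable_EFinP/measurableT_comp.
have := integrable_ae measurableT iS; apply: filterS => x /(_ I).
rewrite ge0_fin_numE// => /nnseries_is_cvg-/(_ (fun=> normr_ge0 _)).
move=> /cvg_series_cvg_0 h; exact/norm_cvg0P.
Qed.

(** * The first-order limit of normalised mixture differences *)

Lemma cvg_sumr (R : realType) T (F : set_system T) {FF : Filter F} (I : finType)
    (u : I -> T -> R) (l : I -> R) :
  (forall i, u i t @[t --> F] --> l i) ->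
  \sum_i u i t @[t --> F] --> \sum_i l i.
Proof. by move=> ul; apply: cvg_big => //; exact: add_continuous. Qed.

Lemma normr_le_sum (R : realType) p q (A : 'M[R]_(p, q)) :
  `|A| <= \sum_i \sum_j `|A i j|.
Proof.
have [/= A0|] := eqVneq `|A| 0.
  by rewrite A0; apply: sumr_ge0 => i _; exact: sumr_ge0.
move=> /mx_norm_neq0[[i j] /= Aij]; rewrite [leLHS]Aij.
rewrite (bigD1 i)//= (bigD1 j)//= -addrA lerDl addr_ge0// ?sumr_ge0//.
by move=> *; exact: sumr_ge0.
Qed.

(** The coefficients come from limits of normalised deviations, so they do not depend on [x].
    Normalising by [deviation] keeps them from all being zero. *)
Lemma first_order_limit (R : realType) d1 d2 m k
    (f : euclidean R m -> 'cV[R]_d1 -> 'M[R]_d2 -> R)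
    (G0 : mixing R d1 d2 k) (G : nat -> mixing R d1 d2 k)
    (U : set_system nat) (UU : UltraFilter U) :
  (forall i, 0 < weight G0 i) ->
  (forall i, (scale G0 i)^T = scale G0 i) ->
  (forall n i, (scale (G n) i)^T = scale (G n) i) ->
  (forall x i, differentiable (fun p : 'cV[R]_d1 * 'M[R]_d2 => f x p.1 p.2)
     (loc G0 i, scale G0 i)) ->
  (forall n, 0 < deviation (G n) G0) ->
  deviation (G n) G0 @[n --> U] --> 0 ->
  exists (a : 'I_k -> R) (b : 'I_k -> 'cV[R]_d1) (c : 'I_k -> 'M[R]_d2),
  [/\ forall i, (c i)^T = c i,
      forall x, (mixture f (G n) x - mixture f G0 x) / deviation (G n) G0
          @[n --> U] -->
        \sum_i (a i * f x (loc G0 i) (scale G0 i)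
              + ((b i)^T *m dtheta f x (loc G0 i) (scale G0 i)) 0 0
              + \tr ((dSigma f x (loc G0 i) (scale G0 i))^T *m c i))
    & ~ forall i, [/\ a i = 0, b i = 0 & c i = 0]].
Proof.
move=> p0 symG0 symG dfx D0 Dto0.
have PU : ProperFilter U := @ultra_proper _ _ UU.
pose D n := deviation (G n) G0.
have Dn0 n : D n != 0 by exact/lt0r_neq0/D0.
pose h i n := atom (G n) i - atom G0 i.
have hD i n : `|h i n| <= D n.
  rewrite /D /deviation (bigD1 i)//= addrAC lerDr addr_ge0//.
  by apply: sumr_ge0 => j _; rewrite addr_ge0 ?normr_ge0.
have wD i n : `|weight (G n) i - weight G0 i| <= D n.
  rewrite /D /deviation (bigD1 i)//= -addrA lerDl addr_ge0 ?normr_ge0//.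
  by apply: sumr_ge0 => j _; rewrite addr_ge0 ?normr_ge0.
have h1D i n s : `|(h i n).1 s 0| <= D n.
  rewrite (le_trans (entry_le_normr _ _ _))// (le_trans _ (hD i n))//.
  by rewrite [leRHS]prod_normE le_max lexx.
have h2D i n s t : `|(h i n).2 s t| <= D n.
  rewrite (le_trans (entry_le_normr _ _ _))// (le_trans _ (hD i n))//.
  by rewrite [leRHS]prod_normE le_max lexx orbT.
have quot (u : nat -> R) : (forall n, `|u n| <= D n) ->
    exists l : R, u n / D n @[n --> U] --> l.
  move=> uD; apply: (@ultra_bounded_cvg _ _ U _ _ 1) => n.
  by rewrite normrM normfV (gtr0_norm (D0 n)) ler_pdivrMr// mul1r.
have /choice[al alP] i := quot _ (wD i).
have /choice[be beP] i : exists be, forall s,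
    (h i n).1 s 0 / D n @[n --> U] --> (be s : R).
  by have /choice[be] s := quot _ (h1D i ^~ s); exists be.
have /choice[ga gaP] i : exists ga, forall st,
    (h i n).2 st.1 st.2 / D n @[n --> U] --> (ga st : R).
  by have /choice[ga] st := quot _ (fun n => h2D i n st.1 st.2); exists ga.
(* The factor [weight G0 i] comes from the product rule for weight times density. *)
exists al, (fun i => \col_s (weight G0 i * be i s)),
  (fun i => \matrix_(s, t) (weight G0 i * ga i (s, t))).
split.
- move=> i; apply/matrixP => s t; rewrite !mxE; congr (_ * _).
  (* Symmetry of the scales makes the quotients at [(s, t)] and [(t, s)] the same sequence, so their
     limits agree. *)
  have hC : (fun n => (h i n).2 s t / D n) = (fun n => (h i n).2 t s / D n).
    apply/funext => n; congr (_ / _).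
    by rewrite /h /= -[in LHS](symG n i) -[in LHS](symG0 i) !mxE.
  have := gaP i (s, t); rewrite /= hC => hst.
  have := cvg_lim (@Rhausdorff R) (gaP i (t, s)).
  rewrite /= (cvg_lim (@Rhausdorff R) hst) => ->//.
- move=> x.
  pose g (p : 'cV[R]_d1 * 'M[R]_d2) := f x p.1 p.2.
  pose d1f i s := 'D_(delta_mx s 0) (fun t => f x t (scale G0 i)) (loc G0 i).
  pose d2f i s t := 'D_(delta_mx s t) (f x (loc G0 i)) (scale G0 i).
  pose dg i := \sum_s be i s * d1f i s + \sum_s \sum_t ga i (s, t) * d2f i s t.
  have dgP i : (g (atom (G n) i) - g (atom G0 i)) / D n @[n --> U] --> dg i.
    rewrite -[dg i]add0r.
    (* The differential at [h i n] is split off: the remainder vanishes in the limit, and the linear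
       part converges entry by entry. *)
    rewrite (_ : (fun n => _) = fun n =>
       (g (atom G0 i + h i n) - g (atom G0 i) - 'd g (atom G0 i) (h i n)) / D n
       +
       'd g (atom G0 i) (h i n) / D n); last first.
      have nE n : atom G0 i + h i n = atom (G n) i by rewrite /h addrC subrK.
      by apply/funext => n; rewrite nE -mulrDl; congr (_ / _); ring.
    apply: cvgD.
      exact: (diff_remainder_cvg (dfx x i) D0 (hD i) Dto0).
    rewrite (_ : (fun n => _) = fun n =>
      \sum_s ((h i n).1 s 0 / D n) * d1f i s
      + \sum_s \sum_t ((h i n).2 s t / D n) * d2f i s t); last first.
      apply/funext => n; rewrite diff_partialE// mulrDl !mulr_suml.
      congr (_ + _).
        by apply: eq_bigr => s _; rewrite mulrAC.
      apply: eq_bigr => s _; rewrite mulr_suml.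
      by apply: eq_bigr => t _; rewrite mulrAC.
    apply: cvgD; apply: cvg_sumr => s.
      by apply: cvgM; [exact: beP|exact: cvg_cst].
    apply: cvg_sumr => t.
    by apply: cvgM; [exact: (gaP i (s, t))|exact: cvg_cst].
  (* Continuity along [U]: a convergent difference quotient is multiplied by [D n], which tends to
     0. *)
  have gP i : g (atom (G n) i) @[n --> U] --> g (atom G0 i).
    have : D n * ((g (atom (G n) i) - g (atom G0 i)) / D n) + g (atom G0 i)
        @[n --> U] --> 0 * dg i + g (atom G0 i).
      by apply: cvgD; [exact: cvgM|exact: cvg_cst].
    rewrite mul0r add0r; under eq_fun => n do
      rewrite mulrC (divfK (Dn0 n)) subrK.
    by [].
  (* Discrete product rule: the weight difference multiplies the density at the moved atom, and the
     weight of [G0] multiplies the density difference. *)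
  rewrite (_ : (fun n => _) = fun n =>
    \sum_i ((weight (G n) i - weight G0 i) / D n * g (atom (G n) i) +
      weight G0 i * ((g (atom (G n) i) - g (atom G0 i)) / D n))); last first.
    apply/funext => n; rewrite /mixture -sumrB mulr_suml; apply: eq_bigr => i _.
    rewrite mulrA mulrAC -mulrDl; congr (_ / _); rewrite /g /atom /=; ring.
  apply: cvg_sumr => i; rewrite -addrA; apply: cvgD; first exact: cvgM.
  rewrite (_ : _ + _ = weight G0 i * dg i).
    by apply: cvgM; [exact: cvg_cst|exact: dgP].
  rewrite mulrDr mulr_sumr; congr (_ + _).
    by rewrite mxE; apply: eq_bigr => s _; rewrite !mxE mulrA.
  rewrite /mxtrace exchange_big/= mulr_sumr; apply: eq_bigr => s _.
  rewrite mxE mulr_sumr; apply: eq_bigr => t _; rewrite !mxE /d2f; ring.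
- move=> abc0.
  have wn i : weight G0 i != 0 by rewrite gt_eqF.
  have al0 i : al i = 0 by case: (abc0 i).
  have be0 i s : be i s = 0.
    have [_ /matrixP/(_ s 0)] := abc0 i; rewrite !mxE => /eqP.
    by rewrite mulf_eq0 (negPf (wn i)) => /eqP.
  have ga0 i s t : ga i (s, t) = 0.
    have [_ _ /matrixP/(_ s t)] := abc0 i; rewrite !mxE => /eqP.
    by rewrite mulf_eq0 (negPf (wn i)) => /eqP.
  (* The sum of the absolute values of all normalised deviations. It tends to 0 if all limits
     vanish, yet it is at least 1, since entrywise sums dominate the norms that make up [D n]. *)
  pose v n : R := \sum_i (`|(weight (G n) i - weight G0 i) / D n| +
    (\sum_s `|(h i n).1 s 0 / D n| + \sum_s \sum_t `|(h i n).2 s t / D n|)).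
  have v0 : v n @[n --> U] --> 0.
    rewrite (_ : 0 = \sum_(i < k) (`|0 : R| + (\sum_(s < d1) `|0 : R| +
        \sum_(s < d2) \sum_(t < d2) `|0 : R|))); last first.
      rewrite big1// => i _; rewrite normr0 big1// big1 ?addr0// => s _.
      exact: big1.
    apply: cvg_sumr => i; apply: cvgD.
      by apply: cvg_norm; rewrite -(al0 i).
    apply: cvgD; apply: cvg_sumr => s.
      by apply: cvg_norm; rewrite -(be0 i s).
    apply: cvg_sumr => t; apply: cvg_norm; rewrite -(ga0 i s t).
    exact: (gaP i (s, t)).
  have v1 n : 1 <= v n.
    rewrite -(ler_pM2r (D0 n)) mul1r -/(D n) {1}/D /deviation.
    rewrite mulr_suml; apply: ler_sum => i _.
    have normD (z : R) : `|z / D n| * D n = `|z|.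
      by rewrite normrM normfV (gtr0_norm (D0 n)) (divfK (Dn0 n)).
    rewrite mulrDl normD lerD2l mulrDl !mulr_suml.
    under eq_bigr do rewrite normD.
    under [X in _ <= _ + X]eq_bigr do
      (rewrite mulr_suml; under eq_bigr do rewrite normD).
    rewrite [leLHS]prod_normE ge_max; apply/andP; split.
      apply: (le_trans (normr_le_sum _)).
      under [leLHS]eq_bigr do rewrite big_ord1.
      rewrite lerDl; apply: sumr_ge0 => s _; exact: sumr_ge0.
    by rewrite (le_trans (normr_le_sum _))// lerDr sumr_ge0.
  have /cvgrPdist_lt/(_ 1 ltr01)/filter_ex[n] := v0.
  by rewrite sub0r normrN => /(le_lt_trans (ler_norm _)); rewrite ltNge v1.
Qed.

(** * Relabelling, and the equivalence of W_1 with the deviation near [G0] *)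

(** Absorbs the matching into the labels, after which [deviation] compares matched atoms. *)
Definition relabel (R : realType) d1 d2 k (s : 'I_k -> 'I_k)
    (G : mixing R d1 d2 k) : mixing R d1 d2 k :=
  Mixing (weight G \o s) (loc G \o s) (scale G \o s).

Lemma relabel_in (R : realType) d1 d2 k (s : 'I_k -> 'I_k)
    (G : mixing R d1 d2 k) Theta Omega :
  injective s -> mixing_in Theta Omega G -> mixing_in Theta Omega (relabel s G).
Proof.
move=> s_inj [w0 w1 Ginj Gin]; split=> /=.
- by move=> i; exact: w0.
- by rewrite -w1 [RHS](reindex_inj s_inj).
- exact: inj_comp Ginj s_inj.
- by move=> i; exact: Gin.
Qed.

Lemma mixture_relabel (R : realType) d1 d2 m k (s : 'I_k -> 'I_k)
    (f : euclidean R m -> 'cV[R]_d1 -> 'M[R]_d2 -> R) (G : mixing R d1 d2 k) :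
  injective s -> mixture f (relabel s G) = mixture f G.
Proof.
by move=> s_inj; apply/funext => x; rewrite /mixture [RHS](reindex_inj s_inj).
Qed.

(** A coupling of the relabelled measure becomes one of [G], at equal cost, when its rows are
    permuted by the inverse of [s]. *)
Lemma wasserstein1_relabel (R : realType) d1 d2 k k' (s : 'I_k -> 'I_k)
    (G : mixing R d1 d2 k) (G' : mixing R d1 d2 k') (q : 'M[R]_(k, k')) :
  injective s -> coupling (relabel s G) G' q ->
  wasserstein 1 G G' <= wasserstein 1 (relabel s G) G'.
Proof.
move=> s_inj cq; rewrite [leRHS](wasserstein1E cq).
apply: lb_le_inf; first by exists (transport_cost 1 (relabel s G) G' q), q.
move=> _ [{cq}q [q0 qG qG'] <-].
pose q' := \matrix_(i, j) q (invF s_inj i) j.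
have q'E i j : q' (s i) j = q i j by rewrite mxE invF_f.
have cq' : coupling G G' q'.
  split=> [i j|i|j]; first by rewrite mxE.
    have := qG (invF s_inj i); rewrite /= f_invF => <-.
    by apply: eq_bigr => j _; rewrite mxE.
  rewrite -qG' (reindex_inj s_inj).
  by apply: eq_bigr => i _; rewrite q'E.
apply: le_trans (wasserstein1_le cq') _.
rewrite !transport_cost1E (reindex_inj s_inj)/=.
by apply: ler_sum => i _; apply: ler_sum => j _; rewrite q'E.
Qed.

Lemma finite_pos_lower_bound (R : realType) (I : finType) (u : I -> R) :
  (forall i, 0 < u i) -> exists2 e, 0 < e & forall i, e <= u i.
Proof.
(* The seed 1 keeps the minimum positive and covers an empty [I]. *)
move=> u0; exists (\big[Num.min/1]_i u i) => [|i]; last exact: bigmin_le_cond.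
by apply/bigmin_gtP; split=> // i _; exact: u0.
Qed.

(** [matching], applied to a near-optimal coupling, bounds the deviation;
    [wasserstein1_le_deviation] gives the other bound. The constants are chosen before [G]. *)
Lemma wasserstein1_deviation (R : realType) d1 d2 k (G0 : mixing R d1 d2 k)
    Theta Omega :
  mixing_in Theta Omega G0 ->
  exists eps K L : R, [/\ 0 < eps, 0 < K, 0 < L &
    forall G : mixing R d1 d2 k, mixing_in Theta Omega G ->
      0 < wasserstein 1 G G0 -> wasserstein 1 G G0 <= eps ->
    exists2 s : 'I_k -> 'I_k, injective s &
      deviation (relabel s G) G0 <= L * wasserstein 1 G G0 /\
      wasserstein 1 G G0 <= K * deviation (relabel s G) G0].
Proof.
case=> w0 w1 G0inj _.
have [pmin pmin0 pminP] := finite_pos_lower_bound w0.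
(* The value 1 on the diagonal is a filler that makes the function positive on all pairs. *)
have [|delta delta0 deltaP] := @finite_pos_lower_bound _ _
    (fun ij : 'I_k * 'I_k => if ij.1 == ij.2 then 1 : R
       else `|atom G0 ij.1 - atom G0 ij.2|).
  move=> [i j] /=; case: eqVneq => // /eqP ij; rewrite normr_gt0 subr_eq0.
  by apply/eqP => /G0inj.
pose M := norm_ratio R d1 d2 *
  (2 + \sum_i \sum_j `|atom G0 i - atom G0 j|).
have M0 : 0 <= M.
  rewrite mulr_ge0 ?norm_ratio_ge0// addr_ge0//.
  by apply: sumr_ge0 => i _; apply: sumr_ge0 => j _; exact: normr_ge0.
(* [matching] is used with cost [2 * W], and the first constant ensures [2 * W / pmin < delta / 2].
   In the third, each atom contributes [2 / pmin] for its position and [4 / delta] for its weight;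
   adding 1 makes the last two constants positive. *)
exists (pmin * delta / 8), (M + 1), (k%:R * (2 / pmin + 4 / delta) + 1).
split; [by rewrite divr_gt0// mulr_gt0|by rewrite ltr_wpDl| |].
  by rewrite ltr_wpDl// mulr_ge0// addr_ge0// divr_ge0// ltW.
move=> G Gin W0 Wle.
have [wG0 wG1 _ _] := Gin.
set W := wasserstein 1 G G0 in W0 Wle *.
have w0' i : 0 <= weight G0 i by exact: ltW.
have [q cq qW] : exists2 q, coupling G G0 q & transport_cost 1 G G0 q < 2 * W.
  apply: wasserstein1_lt; last by rewrite ltr_pMl// ltr1n.
  by apply: product_coupling => // i; exact: ltW.
have [||s s_inj sP] := matching pmin0 pminP delta0 _ cq (ltW qW).
- by move=> i j /negPf ij; have := deltaP (i, j); rewrite /= ij.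
- rewrite ltr_pdivrMr// mulrC; have := mulr_gt0 pmin0 delta0; lra.
have [wR0 wR1 _ _] := relabel_in s_inj Gin.
exists s => //; split.
  rewrite (@le_trans _ _ (k%:R * (2 / pmin + 4 / delta) * W))//; last first.
    by rewrite ler_wpM2r ?ltW// ltrDl.
  rewrite -mulrA mulr_natl -[k in leRHS]card_ord -sumr_const.
  apply: ler_sum => j _; have [dj wj] := sP j.
  rewrite mulrDl addrC lerD//.
    by apply: le_trans dj _; rewrite mulrAC.
  apply: le_trans wj _.
  by rewrite le_eqVlt; apply/orP; left; apply/eqP; field; rewrite gt_eqF.
have cR : coupling (relabel s G) G0
    (\matrix_(i, j) (weight (relabel s G) i * weight G0 j)).
  by apply: product_coupling => // i; exact: ltW.
apply: le_trans (wasserstein1_relabel s_inj cR) _.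
apply: (@le_trans _ _ (M * deviation (relabel s G) G0)).
  by apply: wasserstein1_le_deviation => // i; exact: ltW.
rewrite ler_wpM2r ?lerDl//; apply: sumr_ge0 => j _.
by rewrite addr_ge0 ?normr_ge0.
Qed.

(** * A sequence of counterexamples and its conflict with identifiability *)

Theorem theorem3p1 (R : realType) (d1 d2 m k0 : nat)
    (d1_ge1 : (1 <= d1)%N) (k0_ge1 : (1 <= k0)%N)
    (Theta : set 'cV[R]_d1) (Omega : set 'M[R]_d2)
    (Omega_spd : Omega `<=` @spd R d2)
    (f : euclidean R m -> 'cV[R]_d1 -> 'M[R]_d2 -> R)
    (f_density : forall th S, Theta th -> Omega S ->
       is_density (fun x => f x th S))
    (G0 : mixing R d1 d2 k0) (G0_in : mixing_in Theta Omega G0)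
    (f_identifiable : identifiable1 Theta Omega f)
    (f_lipschitz : uniform_lipschitz1 Theta Omega f) :
  exists eps0 C0 : R, [/\ 0 < eps0, 0 < C0 &
    forall G : mixing R d1 d2 k0, mixing_in Theta Omega G ->
      wasserstein 1 G G0 <= eps0 ->
      ((C0 * wasserstein 1 G G0)%:E
        <= tv_distance (mixture f G) (mixture f G0))%E].
Proof.
apply: contrapT => bad.
have [eps [K [L [eps_gt0 K_gt0 L_gt0 W1dev]]]] := wasserstein1_deviation G0_in.
have [w0 w1 G0inj G0mem] := G0_in.
have mix_measurable (G : mixing R d1 d2 k0) : mixing_in Theta Omega G ->
    measurable_fun setT (mixture f G).
  case=> _ _ _ Gmem; apply: measurable_sum => i.
  apply: measurable_funM; first exact: measurable_cst.
  by have [Th Om] := Gmem i; have [] := f_density _ _ Th Om.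
have step n : exists G : mixing R d1 d2 k0, [/\ mixing_in Theta Omega G,
    0 < deviation G G0, deviation G G0 <= L * eps / n.+1%:R
    & (\int[lebesgue_euclidean R m]_x `|mixture f G x - mixture f G0 x|%:E
       <= (deviation G G0 / (2 ^ n.+1)%:R)%:E)%E].
  (* [2 * K] absorbs the factor one half of [tv_distance] and the bound of W_1 by [K] times the
     deviation; the power of 2 makes the L1 norms summable. *)
  pose C := (2 * K * (2 ^ n.+1)%:R)^-1.
  have C0 : 0 < C by rewrite invr_gt0 !mulr_gt0// ltr0n expn_gt0.
  have [G [Gin Weps VltCW]] : exists G : mixing R d1 d2 k0,
      [/\ mixing_in Theta Omega G,
      wasserstein 1 G G0 <= eps / n.+1%:R
      & (tv_distance (mixture f G) (mixture f G0) <
         (C * wasserstein 1 G G0)%:E)%E].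
    apply: contrapT => noG; apply: bad; exists (eps / n.+1%:R), C.
    split=> //; first by rewrite divr_gt0.
    move=> G Gin Weps; rewrite leNgt; apply/negP => VltCW.
    by apply: noG; exists G.
  have V0 : (0 <= tv_distance (mixture f G) (mixture f G0))%E.
    by rewrite mule_ge0// integral_ge0// => x _; rewrite lee_fin.
  (* A strict upper bound on a non-negative quantity is positive; so W_1 is positive, and then so is
     the deviation used as divisor. *)
  have W0 : 0 < wasserstein 1 G G0.
    by have := le_lt_trans V0 VltCW; rewrite lte_fin pmulr_rgt0.
  have [|s s_inj [devW Wdev]] := W1dev _ Gin W0.
    by rewrite (le_trans Weps)// ler_pdivrMr// ler_peMr ?ler1n// ltW.
  have dev0 : 0 < deviation (relabel s G) G0.
    by rewrite -(pmulr_rgt0 _ K_gt0); exact: lt_le_trans Wdev.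
  exists (relabel s G); split=> //.
  - exact: relabel_in.
  - by rewrite (le_trans devW)// -mulrA ler_pM2l.
  - rewrite mixture_relabel//.
    rewrite -(@lee_pmul2l _ (2^-1)%:E) ?lte_fin ?invr_gt0//.
    apply: (le_trans (ltW VltCW)); rewrite -EFinM lee_fin.
    rewrite (le_trans (ler_wpM2l (ltW C0) Wdev))//.
    rewrite le_eqVlt; apply/orP; left; apply/eqP.
    rewrite /C; field.
    by rewrite !gt_eqF// ltr0n expn_gt0.
have {step}/choice[G GP] := step.
(* [U] refines the filter at infinity, so limits of sequences are also limits along [U]. *)
have [U [UU ooU]] := @ultraFilterLemma _ (@nbhs nat _ \oo) _.
have dev0 n : 0 < deviation (G n) G0 by case: (GP n).
have alongU (u : nat -> R) (l : R) :
    u n @[n --> \oo] --> l -> u n @[n --> U] --> l.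
  by move=> ul A lA; apply: ooU; exact: ul.
have devU : deviation (G n) G0 @[n --> U] --> 0.
  apply: alongU.
  apply: (@squeeze_cvgr _ _ _ _ (cst 0) (fun n => L * eps * harmonic n)).
  - by apply: nearW => n; rewrite ltW//=; case: (GP n).
  - exact: cvg_cst.
  - rewrite -[X in _ --> X](mulr0 (L * eps)).
    by apply: cvgM; [exact: cvg_cst|exact: cvg_harmonic].
have PU : ProperFilter U := @ultra_proper _ _ UU.
have symG n i : (scale (G n) i)^T = scale (G n) i.
  by have [[_ _ _ /(_ i)[_ /Omega_spd[]]]] := GP n.
have symG0 i : (scale G0 i)^T = scale G0 i by have [_ /Omega_spd[]] := G0mem i.
have [df f_id] := f_identifiable.
have dfG0 x i : differentiable (fun p : 'cV[R]_d1 * 'M[R]_d2 => f x p.1 p.2)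
    (loc G0 i, scale G0 i).
  by have [Th Om] := G0mem i; exact: df.
have [a [b [c [symc lim_abc nonzero]]]] :=
  first_order_limit UU w0 symG0 symG dfG0 dev0 devU.
apply: nonzero; apply: (f_id _ (loc G0) (scale G0)) => //.
- by move=> i; case: (G0mem i).
- by move=> i; case: (G0mem i).
pose g n x := (mixture f (G n) x - mixture f G0 x) / deviation (G n) G0.
have mg n : measurable_fun setT (g n).
  apply: measurable_funM; last exact: measurable_cst.
  by apply: measurable_funB; apply: mix_measurable => //; case: (GP n).
have gint n : (\int[lebesgue_euclidean R m]_x `|g n x|%:E
    <= (1 / (2 ^ n.+1)%:R)%:E)%E.
  have [Gin _ _ VG] := GP n.
  under eq_integral do rewrite normrM normfV (gtr0_norm (dev0 n)) mulrC EFinM.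
  rewrite ge0_integralZl//; last 2 first.
  - apply/measurable_EFinP/measurableT_comp => //.
    by apply: measurable_funB; exact: mix_measurable.
  - by rewrite lee_fin invr_ge0 ltW.
  by rewrite lee_pdivrMl// -EFinM mulrA mulr1.
have := ae_cvg0_summable_norm1 (@ler01 R) mg gint.
apply: filterS => x gx.
(* At such [x] the same sequence tends along [U] both to 0 and to the first-order combination;
   limits are unique. *)
have := cvg_lim (@Rhausdorff R) (lim_abc x).
by rewrite (cvg_lim (@Rhausdorff R) (alongU _ _ gx)) => <-.
Qed.
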